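(* Let $n\ge0$ be an integer and let $z\in\mathbb{C}$ with $|z|<1$. Then $${}_2F_1\bigl(1,1+n;\tfrac32+n;z\bigr)=\frac{(1+2n)!!}{(2n)!!}\,\frac{1}{z^{n}(1-z)}\Biggl[\frac{\arctan\sqrt{\frac{z}{1-z}}}{\sqrt{\frac{z}{1-z}}}-(1-z)^n\,\mathcal{Q}_{n-1}\Bigl(\frac{z}{1-z}\Bigr)\Biggr],$$ where $\mathcal{Q}_{-1}(x)=0$ and, for integers $m\ge0$, $$\mathcal{Q}_m(x)=\sum_{k=0}^{m}\Biggl[\sum_{j=0}^{k}\frac{(-1)^j}{1+2j}\binom{1+m}{k-j}\Biggr]x^k.$$
   Context: The Gauss hypergeometric function is ${}_2F_1(a,b;c;z)=\sum_{m=0}^{\infty}\frac{(a)_m(b)_m}{(c)_m}\frac{z^m}{m!}$ for $|z|<1$, where $(a)_0=1$ and $(a)_m=a(a+1)\dotsm(a+m-1)$ for $m\ge1$. $m!!$ is the double factorial, the product $m(m-2)(m-4)\dotsm$ ending in $1$ or $2$, with $0!!=1$. Square root and $\arctan$ are principal branches. At $z=0$ the right-hand side is understood as its limit as $z\to0$ (removable singularity). *)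

(* Defs.v *)
From Stdlib Require Import Arith Reals.
From Coquelicot Require Import Coquelicot.

Open Scope R_scope.

Fixpoint pochhammer (a : C) (m : nat) : C :=
  match m with
  | O => 1
  | S k => pochhammer a k * (a + INR k)
  end%C.

Definition hyp2F1_term (a b c z : C) (m : nat) : C :=
  (pochhammer a m * pochhammer b m / pochhammer c m * (z ^ m / INR (fact m)))%C.

(* "2F1(a,b;c;z) = v": the defining series converges in C, with sum v. *)
Definition is_hyp2F1 (a b c z v : C) : Prop :=
  is_series (K := C_AbsRing) (V := C_NormedModule) (hyp2F1_term a b c z) v.

Fixpoint dfact (m : nat) : nat :=
  match m with
  | S (S k) => (m * dfact k)%nat
  | _ => 1%nat
  end.

(* Principal argument, in (-PI, PI]; the value at 0 is irrelevant. *)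
Definition Carg (z : C) : R :=
  if Rlt_dec (Im z) 0 then - acos (Re z / Cmod z) else acos (Re z / Cmod z).

Definition Clog (z : C) : C := (ln (Cmod z), Carg z).

(* Principal square root: modulus sqrt |z|, argument Carg z / 2. *)
Definition Csqrt (z : C) : C :=
  (sqrt (Cmod z) * cos (Carg z / 2), sqrt (Cmod z) * sin (Carg z / 2)).

(* Principal arctangent, with branch cuts on the imaginary axis outside
   the segment ]-i, i[. *)
Definition Carctan (w : C) : C :=
  ((Clog (1 + Ci * w) - Clog (1 - Ci * w)) / (2 * Ci))%C.

(* [Binomial.C p q] is the binomial coefficient only for q <= p, which holds
   here because k - j <= k <= m. *)
Definition Qcoef (m k : nat) : R :=
  sum_n (fun j : nat =>
    (-1) ^ j / INR (1 + 2 * j) * Binomial.C (1 + m) (k - j)) k.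

Definition Qpoly (m : nat) (x : C) : C :=
  sum_n (G := C_AbelianMonoid)
    (fun k : nat => (RtoC (Qcoef m k) * x ^ k)%C) m.

(* [Qpred n] is Q_{n-1}, with Q_{-1} = 0. *)
Definition Qpred (n : nat) (x : C) : C :=
  match n with
  | O => 0
  | S m => Qpoly m x
  end.

(* The right-hand side as written, meaningful for z <> 0. *)
Definition closed_form (n : nat) (z : C) : C :=
  (INR (dfact (1 + 2 * n)) / INR (dfact (2 * n))
   * (1 / (z ^ n * (1 - z)))
   * (Carctan (Csqrt (z / (1 - z))) / Csqrt (z / (1 - z))
      - (1 - z) ^ n * Qpred n (z / (1 - z))))%C.

(* Main.v *)
Require Import Defs.
From Stdlib Require Import Arith Reals Lra Lia.
From Coquelicot Require Import Coquelicot.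
Open Scope R_scope.

(** Put [t_m = (2m)!!/(2m+1)!!], which is the integral of [(1-u^2)^m] over
    [0,1].  The m-th coefficient of the series is [t_(n+m)/t_n], so the series is
    a shifted tail of [sum t_m z^m], which is the integral of
    [1/(1 - z(1-u^2))]; if [w^2 = z/(1-z)], then [arctan(uw)/(w(1-z))] is an
    antiderivative of the integrand.  The head cut off is the polynomial
    part: [sum_(k<=m) t_k z^k = (1-z)^m Q_m(z/(1-z))], by Pascal's rule and
    [sum_j (-1)^j binom(N,j)/(2j+1) = t_N]. *)

(** * Wallis ratios and their integral form *)

Definition wallis (m : nat) : R :=
  INR (dfact (2 * m)) / INR (dfact (1 + 2 * m)).

Lemma dfact_pos (m : nat) : (0 < dfact m)%nat.
Proof.
  (* The recursion of [dfact] descends by two, so the induction carries two consecutive values. *)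
  enough (0 < dfact m /\ 0 < dfact (S m))%nat by tauto.
  induction m as [|m [IH1 IH2]]; [simpl; lia|].
  split; [exact IH2|].
  change (dfact (S (S m))) with (S (S m) * dfact m)%nat. lia.
Qed.

Lemma wallis_0 : wallis 0 = 1.
Proof. unfold wallis; simpl; field. Qed.

Lemma wallis_S (m : nat) :
  wallis (S m) = wallis m * (2 * INR m + 2) / (2 * INR m + 3).
Proof.
  unfold wallis.
  replace (2 * S m)%nat with (S (S (2 * m))) by lia.
  change (1 + S (S (2 * m)))%nat with (S (S (1 + 2 * m))).
  change (dfact (S (S (2 * m)))) with (S (S (2 * m)) * dfact (2 * m))%nat.
  change (dfact (S (S (1 + 2 * m))))
    with (S (S (1 + 2 * m)) * dfact (1 + 2 * m))%nat.
  pose proof (lt_0_INR _ (dfact_pos (1 + 2 * m))).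
  pose proof (pos_INR m).
  rewrite !mult_INR, !S_INR, !mult_INR. simpl (INR 2). simpl (INR 1).
  field. lra.
Qed.

Lemma wallis_pos (m : nat) : 0 < wallis m.
Proof.
  apply Rdiv_lt_0_compat; apply lt_0_INR, dfact_pos.
Qed.

Lemma wallis_neq_0 (m : nat) : RtoC (wallis m) <> 0%C.
Proof.
  pose proof (wallis_pos m). intros E. injection E. lra.
Qed.

(* [wallis_prim m u] is the integral of (1 - v^2)^m for v from 0 to u. *)
Fixpoint wallis_prim (m : nat) (u : R) : R :=
  match m with
  | O => u
  | S k => (u * (1 - u ^ 2) ^ S k + (2 * INR k + 2) * wallis_prim k u)
           / (2 * INR k + 3)
  end.

Lemma wallis_prim_0 (m : nat) : wallis_prim m 0 = 0.
Proof.
  induction m as [|m IH]; [reflexivity|].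
  cbn [wallis_prim]. rewrite IH. pose proof (pos_INR m). field. lra.
Qed.

Lemma wallis_prim_1 (m : nat) : wallis_prim m 1 = wallis m.
Proof.
  induction m as [|m IH]; [now rewrite wallis_0|].
  cbn [wallis_prim]. rewrite IH, wallis_S. pose proof (pos_INR m).
  simpl pow. field. lra.
Qed.

(** The recursion is integration by parts: in the derivative of its numerator,
    [-(2k+2) u^2 (1-u^2)^k] and [(2k+2) (1-u^2)^k] combine to [(2k+2) (1-u^2)^(k+1)]. *)
Lemma is_derive_wallis_prim (m : nat) (u : R) :
  is_derive (wallis_prim m) u ((1 - u ^ 2) ^ m).
Proof.
  induction m as [|m IH].
  - cbn [wallis_prim pow]. apply (is_derive_id u).
  - cbn [wallis_prim]. pose proof (pos_INR m).
    assert (ED : ex_derive (wallis_prim m) u) by (eexists; exact IH).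
    auto_derive; [exact ED|].
    replace (Derive (fun x => wallis_prim m x) u) with ((1 - u ^ 2) ^ m)
      by (symmetry; apply is_derive_unique, IH).
    simpl Init.Nat.pred.
    change (match m with O => 1 | S _ => INR m + 1 end) with (INR (S m)).
    rewrite S_INR. simpl pow. unfold Rminus.
    set (P := (1 + - (u * (u * 1))) ^ m).
    field. lra.
Qed.

(** * Complex-valued functions of a real parameter *)

Definition is_Cderive (f : R -> C) (t : R) (d : C) : Prop :=
  is_derive (fun s => Re (f s)) t (Re d) /\
  is_derive (fun s => Im (f s)) t (Im d).

Lemma is_Cderive_minus (f g : R -> C) (t : R) (df dg : C) :
  is_Cderive f t df -> is_Cderive g t dg ->
  is_Cderive (fun s => f s - g s)%C t (df - dg)%C.
Proof.
  intros [f1 f2] [g1 g2]; split.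
  - exact (is_derive_minus _ _ _ _ _ f1 g1).
  - exact (is_derive_minus _ _ _ _ _ f2 g2).
Qed.

Lemma is_Cderive_plus (f g : R -> C) (t : R) (df dg : C) :
  is_Cderive f t df -> is_Cderive g t dg ->
  is_Cderive (fun s => f s + g s)%C t (df + dg)%C.
Proof.
  intros [f1 f2] [g1 g2]; split.
  - exact (is_derive_plus _ _ _ _ _ f1 g1).
  - exact (is_derive_plus _ _ _ _ _ f2 g2).
Qed.

Lemma is_Cderive_scal (c : C) (f : R -> C) (t : R) (df : C) :
  is_Cderive f t df -> is_Cderive (fun s => f s * c)%C t (df * c)%C.
Proof.
  intros [f1 f2]; split.
  - apply (is_derive_ext (fun s => Re c * Re (f s) - Im c * Im (f s))).
    { intros s. simpl. unfold Re, Im. ring. }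
    replace (Re (df * c)) with (Re c * Re df - Im c * Im df)
      by (simpl; unfold Re, Im; ring).
    apply (is_derive_minus (V := R_NormedModule));
      apply is_derive_scal; assumption.
  - apply (is_derive_ext (fun s => Re c * Im (f s) + Im c * Re (f s))).
    { intros s. simpl. unfold Re, Im. ring. }
    replace (Im (df * c)) with (Re c * Im df + Im c * Re df)
      by (simpl; unfold Re, Im; ring).
    apply (is_derive_plus (V := R_NormedModule));
      apply is_derive_scal; assumption.
Qed.

Lemma is_Cderive_real (f : R -> R) (t df : R) :
  is_derive f t df -> is_Cderive (fun s => RtoC (f s)) t (RtoC df).
Proof.
  intros Hf; split; simpl; [exact Hf|].
  exact (is_derive_const (V := R_NormedModule) 0 t).
Qed.

Lemma is_Cderive_sum_n (f : nat -> R -> C) (t : R) (df : nat -> C) (N : nat) :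
  (forall m, is_Cderive (f m) t (df m)) ->
  is_Cderive (fun s => sum_n (G := C_AbelianMonoid) (fun m => f m s) N) t
    (sum_n (G := C_AbelianMonoid) df N).
Proof.
  intros Hf. induction N as [|N IH].
  - rewrite sum_O. destruct (Hf 0%nat) as [H1 H2]. split.
    + apply is_derive_ext with (2 := H1). intros s; now rewrite sum_O.
    + apply is_derive_ext with (2 := H2). intros s; now rewrite sum_O.
  - rewrite sum_Sn.
    destruct (is_Cderive_plus _ _ _ _ _ IH (Hf (S N))) as [H1 H2]. split.
    + apply is_derive_ext with (2 := H1). intros s; now rewrite sum_Sn.
    + apply is_derive_ext with (2 := H2). intros s; now rewrite sum_Sn.
Qed.

Lemma im_le_Cmod (c : C) : Rabs (Im c) <= Cmod c.
Proof.
  unfold Cmod. rewrite <- sqrt_Rsqr_abs. apply sqrt_le_1_alt.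
  unfold Rsqr, Im. nra.
Qed.

Lemma Cmod_le_Re_Im (c : C) : Cmod c <= Rabs (Re c) + Rabs (Im c).
Proof.
  replace c with (RtoC (Re c) + Ci * RtoC (Im c))%C at 1.
  - eapply Rle_trans; [apply Cmod_triangle|].
    rewrite Cmod_mult, !Cmod_R.
    replace (Cmod Ci) with 1; [lra|].
    unfold Cmod; simpl. transitivity (sqrt 1); [now rewrite sqrt_1|f_equal; ring].
  - apply injective_projections; unfold Re, Im; simpl; ring.
Qed.

(** The mean value theorem fails for complex values, so it is applied to the real and imaginary
    parts separately; this costs the factor 2. *)
Lemma Cmean_value_bound (f df : R -> C) (M : R) :
  (forall t, 0 <= t <= 1 -> is_Cderive f t (df t)) ->
  (forall t, 0 <= t <= 1 -> Cmod (df t) <= M) ->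
  Cmod (f 1 - f 0)%C <= 2 * M.
Proof.
  intros Hd HM.
  assert (MV : forall (g dg : R -> R),
    (forall t, 0 <= t <= 1 -> is_derive g t (dg t)) ->
    (forall t, 0 <= t <= 1 -> Rabs (dg t) <= M) -> Rabs (g 1 - g 0) <= M).
  { intros g dg H1 H2.
    destruct (MVT_gen g 0 1 dg) as [c [Hc E]].
    - intros x. rewrite Rmin_left, Rmax_right by lra. intros; apply H1; lra.
    - intros x. rewrite Rmin_left, Rmax_right by lra. intros Hx.
      apply derivable_continuous_pt. exists (dg x).
      apply is_derive_Reals, H1, Hx.
    - rewrite Rmin_left, Rmax_right in Hc by lra.
      rewrite E, Rminus_0_r, Rmult_1_r. now apply H2. }
  eapply Rle_trans; [apply Cmod_le_Re_Im|].
  assert (Rabs (Re (f 1) - Re (f 0)) <= M).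
  { apply (MV (fun t => Re (f t)) (fun t => Re (df t))).
    - intros t Ht. apply (Hd t Ht).
    - intros t Ht. eapply Rle_trans; [apply re_le_Cmod|auto]. }
  assert (Rabs (Im (f 1) - Im (f 0)) <= M).
  { apply (MV (fun t => Im (f t)) (fun t => Im (df t))).
    - intros t Ht. apply (Hd t Ht).
    - intros t Ht. eapply Rle_trans; [apply im_le_Cmod|auto]. }
  change (Re (f 1 - f 0)) with (Re (f 1) - Re (f 0)).
  change (Im (f 1 - f 0)) with (Im (f 1) - Im (f 0)). lra.
Qed.

(** * Logarithm and arctangent along a segment *)

Definition slit_plane (c : C) : Prop := Im c <> 0 \/ 0 < Re c.

(** This is the denominator in [tan (arg c / 2) = Im c / (|c| + Re c)]; off the real axis,
    [|Re c| < |c|]. *)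
Lemma slit_plane_Cmod_plus_Re (c : C) : slit_plane c -> 0 < Cmod c + Re c.
Proof.
  intros Hc.
  pose proof (Cmod2_alt c) as E. pose proof (Cmod_ge_0 c) as P.
  destruct Hc as [Hc|Hc]; [|lra].
  assert (0 < Im c ^ 2) by nra. nra.
Qed.

(* The half-angle form is smooth on the whole slit plane, unlike [acos]. *)
Lemma Carg_atan (c : C) :
  slit_plane c -> Carg c = 2 * atan (Im c / (Cmod c + Re c)).
Proof.
  intros Hc. pose proof (slit_plane_Cmod_plus_Re c Hc) as HP.
  pose proof (Cmod2_alt c) as E. pose proof (Cmod_ge_0 c) as P.
  assert (HR : 0 < Cmod c).
  { destruct (Rlt_or_le 0 (Cmod c)); [assumption|].
    assert (Cmod c = 0) by lra. rewrite H0 in *. nra. }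
  set (y := Im c / (Cmod c + Re c)).
  assert (Hcos : Re c / Cmod c = cos (2 * atan y)).
  { rewrite cos_2a_cos, cos_atan.
    assert (HS : 0 < 1 + y²) by (unfold Rsqr; nra).
    pose proof (sqrt_sqrt (1 + y²) (Rlt_le _ _ HS)) as SS.
    pose proof (sqrt_lt_R0 _ HS) as SP.
    replace (2 * (1 / sqrt (1 + y²)) * (1 / sqrt (1 + y²)) - 1)
      with (2 / (sqrt (1 + y²) * sqrt (1 + y²)) - 1) by (field; lra).
    rewrite SS.
    replace (1 + y²) with (2 * Cmod c / (Cmod c + Re c)).
    - field. lra.
    - unfold y, Rsqr. field_simplify_eq; [|lra].
      replace (Im c ^ 2) with (Cmod c ^ 2 - Re c ^ 2) by lra. ring. }
  unfold Carg. rewrite Hcos. pose proof (atan_bound y) as B.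
  (* [acos_cos] wants an angle in [0, PI]; below the real axis the angle is negative, and the minus
     sign in [Carg] compensates. *)
  destruct (Rlt_dec (Im c) 0) as [Hn|Hn].
  - assert (y < 0).
    { unfold y, Rdiv. pose proof (Rinv_0_lt_compat _ HP). nra. }
    assert (atan y < 0) by (rewrite <- atan_0; now apply atan_increasing).
    rewrite <- cos_neg, acos_cos; lra.
  - assert (0 <= y).
    { unfold y, Rdiv. pose proof (Rinv_0_lt_compat _ HP). nra. }
    assert (0 <= atan y).
    { rewrite <- atan_0. destruct (Rle_lt_or_eq_dec _ _ H) as [L|<-].
      - left. now apply atan_increasing.
      - lra. }
    rewrite acos_cos; lra.
Qed.

Lemma Cmod_sqr (c : C) : Cmod c * Cmod c = Re c * Re c + Im c * Im c.
Proof. pose proof (Cmod2_alt c). simpl in *. lra. Qed.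

(** Openness of the slit plane: the half-angle formula for [Carg] then holds around [t], and may be
    differentiated in its place. *)
Lemma slit_plane_locally (v : C) (t : R) :
  slit_plane (1 + RtoC t * v)%C ->
  locally t (fun s => slit_plane (1 + RtoC s * v)%C).
Proof.
  destruct v as [a b].
  assert (CA : continuous (fun s => 1 + s * a) t)
    by (apply (ex_derive_continuous (V := R_NormedModule)); auto_derive; auto).
  assert (CB : continuous (fun s => s * b) t)
    by (apply (ex_derive_continuous (V := R_NormedModule)); auto_derive; auto).
  unfold slit_plane; simpl.
  intros [H|H].
  - assert (H' : t * b <> 0) by (contradict H; lra).
    generalize (CB _ (open_neq 0 _ H')). unfold filtermap.
    apply filter_imp. intros s Hs. left. contradict Hs. lra.
  - assert (H' : 0 < 1 + t * a) by lra.
    generalize (CA _ (open_gt 0 _ H')). unfold filtermap.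
    apply filter_imp. intros s Hs. right. lra.
Qed.

(** For [c = p + iq] moving with velocity [a + ib] and [r = |c|], the left side is the derivative of
    [2 atan (q / (r + p))] and the right side is [Im ((a + ib) / c)]. *)
Lemma half_angle_derivative (r p q a b : R) :
  0 < r -> 0 < r + p -> r * r = p * p + q * q ->
  2 * ((b / (r + p) - q * ((p * a + q * b) / r + a) / ((r + p) * (r + p)))
       / (1 + q / (r + p) * (q / (r + p))))
  = (p * b - q * a) / (r * r).
Proof.
  intros Hr HD E.
  replace (1 + q / (r + p) * (q / (r + p))) with (2 * r / (r + p)).
  - field_simplify_eq; [|lra].
    replace (q ^ 2) with (r * r - p * p) by (simpl; lra). ring.
  - field_simplify_eq; [|lra].
    replace (q ^ 2) with (r * r - p * p) by (simpl; lra). ring.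
Qed.

Lemma is_Cderive_Clog (v : C) (t : R) :
  slit_plane (1 + RtoC t * v)%C ->
  is_Cderive (fun s => Clog (1 + RtoC s * v)%C) t (v / (1 + RtoC t * v))%C.
Proof.
  intros Hs. pose proof (slit_plane_locally v t Hs) as HL.
  pose proof (slit_plane_Cmod_plus_Re _ Hs) as HP.
  pose proof (Cmod_sqr (1 + RtoC t * v)%C) as HQ.
  assert (HR : 0 < Cmod (1 + RtoC t * v)%C).
  { apply Cmod_gt_0. intros E. rewrite E, Cmod_0 in HP. simpl in HP. lra. }
  destruct v as [a b].
  set (r := Cmod (1 + RtoC t * (a, b))%C) in *.
  simpl in HP, HQ.
  assert (Er : r = sqrt ((1 + t * a) * (1 + t * a) + (t * b) * (t * b))).
  { unfold r, Cmod. f_equal. simpl. ring. }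
  assert (HQ' : r * r = (1 + t * a) * (1 + t * a) + (t * b) * (t * b))
    by (rewrite HQ; ring).
  assert (HP' : 0 < r + (1 + t * a)) by lra.
  assert (HQp : 0 < (1 + t * a) * (1 + t * a) + (t * b) * (t * b)) by nra.
  split.
  - apply (is_derive_ext
      (fun s => ln (sqrt ((1 + s * a) * (1 + s * a) + (s * b) * (s * b))))).
    { intros s. unfold Clog, Cmod; simpl. do 2 f_equal. ring. }
    auto_derive.
    + rewrite <- Er. repeat split; auto.
    + rewrite <- Er. simpl.
      replace ((1 + (t * a - 0 * b)) * ((1 + (t * a - 0 * b)) * 1) +
        (0 + (t * b + 0 * a)) * ((0 + (t * b + 0 * a)) * 1))
        with (r * r) by (rewrite HQ'; ring).
      field. lra.
  - apply (is_derive_ext_loc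
      (fun s => 2 * atan (s * b /
        (sqrt ((1 + s * a) * (1 + s * a) + (s * b) * (s * b)) + (1 + s * a))))).
    { revert HL. apply filter_imp. intros s Hs'.
      change (Im (Clog ?c)) with (Carg c). rewrite Carg_atan by exact Hs'.
      do 2 f_equal. unfold Cmod; simpl. f_equal; [ring|].
      f_equal; [f_equal; ring | ring]. }
    auto_derive.
    + rewrite <- Er. repeat split; auto. lra.
    + rewrite <- Er. simpl.
      replace ((1 + (t * a - 0 * b)) * ((1 + (t * a - 0 * b)) * 1) +
        (0 + (t * b + 0 * a)) * ((0 + (t * b + 0 * a)) * 1))
        with (r * r) by (rewrite HQ'; ring).
      etransitivity; [|etransitivity;
        [apply (half_angle_derivative r (1 + t * a) (t * b) a b HR HP' HQ')|]].
      * f_equal. unfold Rdiv. f_equal; [field; lra|]. f_equal. ring.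
      * field. lra.
Qed.

(** The double-angle formulas reduce this to the cosine and sine of [Carg x]; the sign branch of
    [Carg] turns [|Im x|] into [Im x]. *)
Lemma Csqrt_sqr (x : C) : x <> 0%C -> (Csqrt x * Csqrt x)%C = x.
Proof.
  intros Hx. apply Cmod_gt_0 in Hx.
  pose proof (Cmod_sqr x) as E.
  assert (HC : cos (Carg x) = Re x / Cmod x /\ sin (Carg x) = Im x / Cmod x).
  { assert (B : -1 <= Re x / Cmod x <= 1).
    { pose proof (re_le_Cmod x) as L. apply Rabs_le_between in L.
      split; apply (Rmult_le_reg_r (Cmod x)); auto;
      unfold Rdiv; rewrite ?Rmult_assoc, ?Rinv_l by lra; lra. }
    assert (S : sin (acos (Re x / Cmod x)) = Rabs (Im x) / Cmod x).
    { rewrite sin_acos by exact B. apply sqrt_lem_1.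
      - unfold Rsqr. nra.
      - apply Rdiv_le_0_compat; [apply Rabs_pos|lra].
      - unfold Rsqr. field_simplify_eq; [|lra].
        rewrite pow2_abs. simpl. lra. }
    unfold Carg. destruct (Rlt_dec (Im x) 0) as [Hn|Hn].
    - rewrite cos_neg, sin_neg, S, cos_acos by exact B.
      rewrite Rabs_left by exact Hn. split; [reflexivity|field; lra].
    - rewrite S, cos_acos by exact B.
      rewrite Rabs_right by lra. split; reflexivity. }
  destruct HC as [HC HS].
  replace (Carg x) with (2 * (Carg x / 2)) in HC, HS by field.
  rewrite cos_2a in HC. rewrite sin_2a in HS.
  pose proof (sqrt_sqrt (Cmod x) (Rlt_le _ _ Hx)) as SS.
  unfold Csqrt. set (C1 := cos (Carg x / 2)) in *. set (S1 := sin (Carg x / 2)) in *.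
  set (r := sqrt (Cmod x)) in *.
  destruct x as [p q]. unfold Cmult; simpl in *. f_equal.
  - replace (r * C1 * (r * C1) - r * S1 * (r * S1)) with
      ((r * r) * (C1 * C1 - S1 * S1)) by ring.
    rewrite SS, HC. field. lra.
  - replace (r * C1 * (r * S1) + r * S1 * (r * C1)) with
      ((r * r) * (2 * S1 * C1)) by ring.
    rewrite SS, HS. field. lra.
Qed.

(** * Complex finite sums and the arctangent integral *)

Local Notation Csum := (sum_n (G := C_AbelianMonoid)).

(** The generic sum lemmas leave equalities typed at the carrier of an algebraic structure; retyping
    them lets [ring] and [field] recognise [C] or [R]. *)
Ltac as_eq T :=
  match goal with |- @eq _ ?x ?y => change (@eq T x y) end.

Lemma Csum_S (a : nat -> C) (N : nat) : Csum a (S N) = (Csum a N + a (S N))%C.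
Proof. exact (sum_Sn a N). Qed.

Lemma Csum_S_first (a : nat -> C) (N : nat) :
  Csum a (S N) = (a O + Csum (fun k => a (S k)) N)%C.
Proof.
  induction N as [|N IH].
  - rewrite Csum_S, !sum_O. reflexivity.
  - rewrite Csum_S, IH, (Csum_S (fun k => a (S k))). as_eq C. ring.
Qed.

Lemma Csum_mult_l (c : C) (a : nat -> C) (N : nat) :
  Csum (fun k => c * a k)%C N = (c * Csum a N)%C.
Proof. exact (sum_n_mult_l (K := C_Ring) c a N). Qed.

Lemma Csum_geom (q : C) (N : nat) :
  ((1 - q) * Csum (fun m => q ^ m) N = 1 - q ^ S N)%C.
Proof.
  induction N as [|N IH].
  - rewrite sum_O. simpl. as_eq C. ring.
  - rewrite Csum_S, Cmult_plus_distr_l, IH. simpl. as_eq C. ring.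
Qed.

Lemma RtoC_neq_0 (x : R) : x <> 0 -> RtoC x <> 0%C.
Proof. intros H E. apply H. now injection E. Qed.

Lemma C1_minus_neq_0 (q : C) : Cmod q < 1 -> (1 - q)%C <> 0%C.
Proof.
  intros H E. apply Cminus_eq_contra in E; [exact E|].
  intros <-. rewrite Cmod_1 in H. lra.
Qed.

Lemma Cmod_1_minus_ge (q : C) : 1 - Cmod q <= Cmod (1 - q)%C.
Proof.
  pose proof (Cmod_triangle (1 - q) q) as H.
  replace (1 - q + q)%C with (RtoC 1) in H by ring.
  rewrite Cmod_1 in H. lra.
Qed.

Lemma is_Cderive_ext (f g : R -> C) (t : R) (d e : C) :
  (forall s, f s = g s) -> d = e -> is_Cderive f t d -> is_Cderive g t e.
Proof.
  intros H <- [H1 H2]. split.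
  - apply is_derive_ext with (2 := H1). intros s; now rewrite H.
  - apply is_derive_ext with (2 := H2). intros s; now rewrite H.
Qed.

Lemma Ci_sqr : (Ci * Ci = - (1))%C.
Proof. apply injective_projections; simpl; ring. Qed.

Lemma slit_plane_neq_0 (c : C) : slit_plane c -> c <> 0%C.
Proof. intros [H|H] ->; simpl in H; lra. Qed.

(** Partial fractions: the logarithmic derivatives [iw/(1 + itw)] and [-iw/(1 - itw)] differ by
    [2iw/(1 + t^2 w^2)]. *)
Lemma is_Cderive_Carctan (w : C) (t : R) :
  slit_plane (1 + RtoC t * (Ci * w))%C ->
  slit_plane (1 + RtoC t * (- Ci * w))%C ->
  is_Cderive (fun s => Carctan (RtoC s * w)) t
    (w / (1 + RtoC t * w * (RtoC t * w)))%C.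
Proof.
  intros Hp Hm.
  pose proof (is_Cderive_scal (/ (2 * Ci))%C _ _ _
    (is_Cderive_minus _ _ _ _ _ (is_Cderive_Clog _ _ Hp) (is_Cderive_Clog _ _ Hm))) as H.
  apply slit_plane_neq_0 in Hp. apply slit_plane_neq_0 in Hm.
  pose proof Ci_nz. pose proof Ci_sqr as I2.
  apply is_Cderive_ext with (3 := H).
  - intros s. unfold Carctan, Cdiv. do 2 f_equal; f_equal; ring.
  - assert (E : ((1 + RtoC t * (Ci * w)) * (1 + RtoC t * (- Ci * w))
       = 1 + RtoC t * w * (RtoC t * w))%C).
    { transitivity (1 - Ci * Ci * (RtoC t * w * (RtoC t * w)))%C; [ring|].
      rewrite I2. ring. }
    rewrite <- E. field.
    repeat split; auto.
Qed.

(* If [t w] is purely imaginary, [w^2 = z/(1-z)] with [|z| < 1] forces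
   [|Im w| < 1], so the branch cuts are avoided. *)
Lemma slit_plane_Ci_mult (z w : C) (t : R) :
  Cmod z < 1 -> (w * w * (1 - z) = z)%C -> 0 <= t <= 1 ->
  slit_plane (1 + RtoC t * (Ci * w))%C.
Proof.
  intros Hz Hw Ht. pose proof (re_le_Cmod z) as L. apply Rabs_le_between in L.
  destruct w as [a b]. destruct z as [p q].
  destruct (Req_dec (t * a) 0) as [E|E].
  - right. simpl.
    destruct (Rmult_integral _ _ E) as [->| ->]; [lra|].
    apply (f_equal Re) in Hw. simpl in Hw, L.
    (* Since [p < 1], this makes [b^2 - 1 = -1/(1-p)] negative. *)
    assert (Ep : (b * b - 1) * (1 - p) + 1 = 0) by lra.
    assert (b * b < 1) by nra. assert (b < 1) by nra.
    assert (t * b < 1) by (destruct (Rle_lt_dec b 0); nra). lra.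
  - left. simpl. contradict E. lra.
Qed.

(* The mean value bound is applied to the partial sum, integrated termwise up to
   [s], minus the antiderivative: the difference of the integrands is
   [q^(N+1)/(1-q)] up to sign, with [q = z(1-s^2)]. *)
Lemma is_series_wallis (z w : C) :
  Cmod z < 1 -> w <> 0%C -> (w * w * (1 - z) = z)%C ->
  is_series (K := C_AbsRing) (V := C_NormedModule)
    (fun m => RtoC (wallis m) * z ^ m)%C (Carctan w / (w * (1 - z)))%C.
Proof.
  intros Hz Hw0 Hw. pose proof (C1_minus_neq_0 z Hz) as Hz1.
  assert (B : forall N, Cmod (Csum (fun m => RtoC (wallis m) * z ^ m)%C N
     - Carctan w / (w * (1 - z)))%C <= 2 * (Cmod z ^ S N / (1 - Cmod z))).
  { intros N.
    set (f := fun s : R => (Csum (fun m => RtoC (wallis_prim m s) * z ^ m) N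
      - Carctan (RtoC s * w) * (/ (w * (1 - z))))%C).
    assert (f0 : f 0 = 0%C).
    { unfold f. rewrite (sum_n_ext _ (fun m => 0 * z ^ m)%C).
      - rewrite Csum_mult_l.
        replace (Carctan (0 * w)) with (RtoC 0); [ring|].
        unfold Carctan. rewrite Cmult_0_l, Cmult_0_r. unfold Cminus, Cdiv.
        rewrite Copp_0, Cplus_opp_r. ring.
      - intros m. now rewrite wallis_prim_0. }
    assert (f1 : f 1 = (Csum (fun m => RtoC (wallis m) * z ^ m)
      N - Carctan w / (w * (1 - z)))%C).
    { unfold f. rewrite Cmult_1_l. unfold Cdiv. f_equal.
      apply sum_n_ext. intros m. now rewrite wallis_prim_1. }
    rewrite <- f1.
    replace (f 1) with (f 1 - f 0)%C by (rewrite f0; ring).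
    apply (Cmean_value_bound f (fun t => - ((z * RtoC (1 - t ^ 2)) ^ S N
      / (1 - z * RtoC (1 - t ^ 2))))%C).
    - intros t Ht.
      assert (Hq : Cmod (z * RtoC (1 - t ^ 2)) < 1).
      { rewrite Cmod_mult, Cmod_R, Rabs_right by nra.
        pose proof (Cmod_ge_0 z). nra. }
      assert (Sm : slit_plane (1 + RtoC t * (- Ci * w))%C).
      (* The second logarithm is the first one for [-w], which has the same square. *)
      { replace (- Ci * w)%C with (Ci * (- w))%C by ring.
        apply (slit_plane_Ci_mult z); auto.
        rewrite <- Hw at 2. ring. }
      pose proof (is_Cderive_minus _ _ _ _ _
        (is_Cderive_sum_n _ t _ N (fun m => is_Cderive_scal (z ^ m) _ _ _
           (is_Cderive_real _ _ _ (is_derive_wallis_prim m t))))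
        (is_Cderive_scal (/ (w * (1 - z)))%C _ _ _
          (is_Cderive_Carctan w t (slit_plane_Ci_mult z w t Hz Hw Ht) Sm))) as H.
      apply is_Cderive_ext with (3 := H); [reflexivity|].
      set (q := (z * RtoC (1 - t ^ 2))%C) in *.
      pose proof (C1_minus_neq_0 q Hq) as Hq1.
      rewrite (sum_n_ext _ (fun m => q ^ m)%C).
      2:{ intros m. unfold q. rewrite Cpow_mult_l, RtoC_pow. apply Cmult_comm. }
      (* By [w^2 (1-z) = z], the derivative of the arctangent term becomes [1/(1-q)], the full
         geometric series. *)
      assert (E : ((1 + RtoC t * w * (RtoC t * w)) * (1 - z) = 1 - q)%C).
      { unfold q.
        transitivity (1 - z + RtoC t * RtoC t * (w * w * (1 - z)))%C; [ring|].
        rewrite Hw, RtoC_minus, RtoC_pow. ring. }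
      assert (E2 : (1 + RtoC t * w * (RtoC t * w))%C <> 0%C).
      { intros E0. rewrite E0, Cmult_0_l in E. auto. }
      replace (w / (1 + RtoC t * w * (RtoC t * w)) * / (w * (1 - z)))%C
        with (/ (1 - q))%C by (rewrite <- E; field; auto).
      pose proof (Csum_geom q N) as G.
      replace (Csum (fun m => q ^ m)%C N) with ((1 - q ^ S N) / (1 - q))%C
        by (rewrite <- G; field; auto).
      field; auto.
    - intros t Ht.
      (* With [|q| <= |z|] on all of [0,1], the numerator is at most [|z|^(N+1)] and the denominator
         at least [1 - |z|]. *)
      assert (Hy : Cmod (z * RtoC (1 - t ^ 2)) <= Cmod z).
      { rewrite Cmod_mult, Cmod_R, Rabs_right by nra.
        pose proof (Cmod_ge_0 z). nra. }
      set (q := (z * RtoC (1 - t ^ 2))%C) in *.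
      pose proof (Cmod_1_minus_ge q). pose proof (Cmod_ge_0 q).
      rewrite Cmod_opp, Cmod_div by (apply C1_minus_neq_0; lra).
      rewrite Cmod_pow. unfold Rdiv. apply Rmult_le_compat.
      + apply pow_le; lra.
      + left; apply Rinv_0_lt_compat; lra.
      + apply pow_incr; lra.
      + apply Rinv_le_contravar; lra. }
  apply (filterlim_locally (U := C_UniformSpace)). intros eps.
  assert (LG : is_lim_seq (fun N => 2 * (Cmod z ^ S N / (1 - Cmod z))) 0).
  { replace (Finite 0) with (Rbar_mult (2 * Cmod z / (1 - Cmod z)) 0)
      by (simpl; f_equal; ring).
    apply (is_lim_seq_ext (fun N => 2 * Cmod z / (1 - Cmod z) * Cmod z ^ N)).
    - intros N. simpl. field. lra.
    - apply is_lim_seq_scal_l, is_lim_seq_geom.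
      rewrite Rabs_right; [exact Hz|]. apply Rle_ge, Cmod_ge_0. }
  apply is_lim_seq_spec in LG. destruct (LG eps) as [N0 HN].
  exists N0. intros N HNN. specialize (HN N HNN). specialize (B N).
  apply (norm_compat1 (K := C_AbsRing) (V := C_NormedModule)).
  change (Cmod (Csum (fun m => RtoC (wallis m) * z ^ m)%C N
     - Carctan w / (w * (1 - z)))%C < eps).
  rewrite Rminus_0_r in HN. apply Rabs_lt_between in HN. lra.
Qed.

(** * The polynomial part *)

(** This expands [(-1 + 1)^(N+1)]; the successor exponent excludes [0^0 = 1]. *)
Lemma sum_alternating_binomial (N : nat) :
  sum_n (fun j => (-1) ^ j * Binomial.C (S N) j) (S N) = 0.
Proof.
  rewrite sum_n_Reals.
  pose proof (binomial (-1) 1 (S N)) as H.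
  replace (-1 + 1) with 0 in H by ring. rewrite pow_i in H by lia.
  rewrite H. apply sum_eq. intros i _. rewrite pow1. ring.
Qed.

(** Both sides are the integral of [(1-u^2)^N] over [0,1], the left one expanded term by term. The
    proof checks that the sum satisfies the recurrence [wallis_S]. *)
Lemma sum_binomial_wallis (N : nat) :
  sum_n (fun j => (-1) ^ j / INR (1 + 2 * j) * Binomial.C N j) N = wallis N.
Proof.
  induction N as [|N IH].
  - rewrite sum_O, wallis_0, C_n_n. simpl. field.
  - rewrite wallis_S, <- IH. pose proof (pos_INR N) as PN.
    pose proof (sum_alternating_binomial N) as A.
    rewrite sum_Sn, C_n_n in *.
    change plus with Rplus in *.
    (* From [(N+1) binom(N,j) = (N+1-j) binom(N+1,j)]: the combination of binomials on the right is
       [(2j+1) binom(N+1,j)], which cancels the denominator. The term [j = N+1] has been split off,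
       as [pascal_step2] divides by [N+1-j]. *)
    assert (E : sum_n (fun j => (-1) ^ j * Binomial.C (S N) j) N
      = (2 * INR N + 3) *
         sum_n (fun j => (-1) ^ j / INR (1 + 2 * j) * Binomial.C (S N) j) N
        - (2 * INR N + 2) *
         sum_n (fun j => (-1) ^ j / INR (1 + 2 * j) * Binomial.C N j) N).
    { rewrite <- !(sum_n_mult_l (K := R_Ring)).
      rewrite !sum_n_Reals, <- minus_sum. apply sum_eq. intros j Hj.
      change mult with Rmult. rewrite (pascal_step2 N j) by exact Hj.
      rewrite minus_INR, plus_INR, mult_INR, !S_INR by lia.
      simpl (INR 0). apply le_INR in Hj. pose proof (pos_INR j).
      field. lra. }
    rewrite E in A.
    replace (INR (1 + 2 * S N)) with (2 * INR N + 3)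
      by (rewrite plus_INR, mult_INR, (S_INR N); simpl; ring).
    as_eq R.
    field_simplify_eq; [|lra]. simpl in A |- *. lra.
Qed.

Lemma Qcoef_0_r (m : nat) : Qcoef m 0 = 1.
Proof. unfold Qcoef. rewrite sum_O, C_n_0. simpl. field. Qed.

(* [k = m + 1] lies outside the range of Q_m, but is the boundary term that
   Pascal's rule needs. *)
Lemma Qcoef_diag_S (m : nat) : Qcoef m (S m) = wallis (S m).
Proof.
  unfold Qcoef. rewrite <- sum_binomial_wallis. apply sum_n_ext_loc.
  intros j Hj. f_equal. symmetry. now apply pascal_step1.
Qed.

(** Pascal's rule acts on the terms [j <= k]; the last term [j = k+1] has binomial 1 both in
    [Qcoef (S m) (S k)] and in [Qcoef m (S k)]. *)
Lemma Qcoef_pascal (m k : nat) :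
  (k <= m)%nat -> Qcoef (S m) (S k) = Qcoef m (S k) + Qcoef m k.
Proof.
  intros Hk. unfold Qcoef. rewrite !sum_Sn. change plus with Rplus.
  rewrite Nat.sub_diag, !C_n_0.
  rewrite (sum_n_ext_loc _ (fun j =>
     plus ((-1) ^ j / INR (1 + 2 * j) * Binomial.C (1 + m) (S k - j))
       ((-1) ^ j / INR (1 + 2 * j) * Binomial.C (1 + m) (k - j)))).
  - rewrite (sum_n_plus (G := R_AbelianMonoid)). change plus with Rplus.
    rewrite Rplus_assoc, (Rplus_comm (sum_n _ _) (_ * 1)), <- Rplus_assoc. reflexivity.
  - intros j Hj. rewrite Nat.sub_succ_l by exact Hj.
    change (1 + S m)%nat with (S (1 + m)).
    rewrite <- (pascal (1 + m) (k - j)) by lia.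
    change plus with Rplus. as_eq R. ring.
Qed.

(** By [Qcoef_pascal], the sum for [m+1] is [1-z] times plus [z] times the sum for [m], plus the
    boundary term [wallis (S m) z^(m+1)]. The weights add to 1, so exactly one new term of the
    right-hand sum appears. *)
Lemma Qcoef_sum_wallis (m : nat) (z : C) :
  Csum (fun k => RtoC (Qcoef m k) * z ^ k * (1 - z) ^ (m - k))%C m
  = Csum (fun k => RtoC (wallis k) * z ^ k)%C m.
Proof.
  induction m as [|m IH].
  - rewrite !sum_O, Qcoef_0_r, wallis_0. simpl. as_eq C. ring.
  - rewrite (Csum_S (fun k => RtoC (wallis k) * z ^ k)%C), <- IH.
    assert (E : Csum (fun k => RtoC (Qcoef m k) * z ^ k * (1 - z) ^ (S m - k))%C (S m)
      = ((1 - z) * Csum (fun k => RtoC (Qcoef m k) * z ^ k * (1 - z) ^ (m - k)) m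
         + RtoC (wallis (S m)) * z ^ S m)%C).
    { rewrite Csum_S, Qcoef_diag_S, Nat.sub_diag. f_equal; [|simpl; ring].
      rewrite <- Csum_mult_l. apply sum_n_ext_loc. intros k Hk.
      rewrite Nat.sub_succ_l by exact Hk. simpl. as_eq C. ring. }
    (* [Qcoef_pascal] covers only successor indices, so [k = 0] is set apart; its coefficient is 1
       for both [m] and [m+1]. *)
    rewrite Csum_S_first in E |- *. rewrite Qcoef_0_r in E |- *.
    rewrite (sum_n_ext_loc _ (fun k =>
       plus (RtoC (Qcoef m (S k)) * z ^ S k * (1 - z) ^ (S m - S k))
        (z * (RtoC (Qcoef m k) * z ^ k * (1 - z) ^ (m - k))))%C).
    + rewrite (sum_n_plus (G := C_AbelianMonoid)), Csum_mult_l.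
      change (@plus C_AbelianMonoid) with Cplus.
      rewrite Cplus_assoc, E. as_eq C. ring.
    + intros k Hk. rewrite Qcoef_pascal, RtoC_plus by exact Hk.
      change (@plus C_AbelianMonoid) with Cplus. simpl. as_eq C. ring.
Qed.

Lemma Qpoly_sum_wallis (m : nat) (z : C) :
  (1 - z)%C <> 0%C ->
  ((1 - z) ^ m * Qpoly m (z / (1 - z)))%C
  = Csum (fun k => RtoC (wallis k) * z ^ k)%C m.
Proof.
  intros Hz. rewrite <- Qcoef_sum_wallis. unfold Qpoly.
  rewrite <- Csum_mult_l. apply sum_n_ext_loc. intros k Hk.
  unfold Cdiv. rewrite Cpow_mult_l, Cpow_inv by exact Hz.
  replace m with (m - k + k)%nat at 1 by lia. rewrite Cpow_add_r.
  as_eq C. field. now apply Cpow_nz.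
Qed.

(** * The hypergeometric series *)

Lemma pochhammer_1 (m : nat) : pochhammer 1 m = INR (fact m).
Proof.
  induction m as [|m IH]; [reflexivity|].
  cbn [pochhammer]. rewrite IH. change (fact (S m)) with (S m * fact m)%nat.
  rewrite mult_INR, S_INR, RtoC_mult, RtoC_plus. ring.
Qed.

Lemma pochhammer_real (x : R) (m : nat) :
  0 < x -> exists y, 0 < y /\ pochhammer (RtoC x) m = RtoC y.
Proof.
  intros Hx. induction m as [|m [y [Hy E]]].
  - exists 1. split; [lra|reflexivity].
  - exists (y * (x + INR m)). pose proof (pos_INR m). split; [nra|].
    cbn [pochhammer]. now rewrite E, RtoC_mult, RtoC_plus.
Qed.

(** Each new factor [(1+n+m)/(3/2+n+m)] is the ratio [(2(n+m)+2)/(2(n+m)+3)] of [wallis_S]. *)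
Lemma pochhammer_ratio (n m : nat) :
  (pochhammer (1 + INR n) m / pochhammer (3 / 2 + INR n) m
   = wallis (n + m) / wallis n)%C.
Proof.
  pose proof (pos_INR n) as Pn.
  assert (E32 : (3 / 2 + INR n)%C = RtoC (3 / 2 + INR n))
    by (rewrite RtoC_plus, RtoC_div by lra; reflexivity).
  rewrite E32.
  induction m as [|m IH].
  - rewrite Nat.add_0_r. simpl. field. apply wallis_neq_0.
  - destruct (pochhammer_real (3 / 2 + INR n) m) as [y [Hy Ey]]; [lra|].
    cbn [pochhammer]. rewrite Ey in *.
    rewrite <- plus_n_Sm, wallis_S, plus_INR. pose proof (pos_INR m) as Pm.
    pose proof (wallis_neq_0 n).
    transitivity ((pochhammer (1 + INR n) m / y) *
      ((1 + INR n + INR m) / (RtoC (3 / 2 + INR n) + INR m)))%C.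
    + field. split; [|apply RtoC_neq_0; lra].
      rewrite <- RtoC_plus. apply RtoC_neq_0. lra.
    + rewrite IH. rewrite <- !RtoC_plus, <- !RtoC_div.
      * rewrite <- RtoC_mult. f_equal. field.
        pose proof (wallis_pos n). lra.
      * apply Rgt_not_eq, wallis_pos.
      * lra.
      * apply Rgt_not_eq, wallis_pos.
Qed.

Lemma hyp2F1_term_wallis (n m : nat) (z : C) :
  hyp2F1_term 1 (1 + INR n)%C (3 / 2 + INR n)%C z m
  = (wallis (n + m) / wallis n * z ^ m)%C.
Proof.
  unfold hyp2F1_term. rewrite <- pochhammer_ratio, pochhammer_1.
  unfold Cdiv.
  set (f := RtoC (INR (fact m))). set (p := pochhammer (1 + INR n) m).
  set (q := pochhammer _ m).
  transitivity (p * / q * z ^ m * (f * / f))%C; [ring|].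
  rewrite Cinv_r; [ring|]. apply RtoC_neq_0, INR_fact_neq_0.
Qed.

(** * Behaviour of the series near the origin *)

Lemma wallis_decreasing (n m : nat) : wallis (n + m) <= wallis n.
Proof.
  induction m as [|m IH]; [rewrite Nat.add_0_r; lra|].
  rewrite <- plus_n_Sm, wallis_S.
  pose proof (wallis_pos (n + m)). pose proof (pos_INR (n + m)).
  enough (wallis (n + m) * (2 * INR (n + m) + 2) / (2 * INR (n + m) + 3)
    <= wallis (n + m)) by lra.
  apply (Rmult_le_reg_r (2 * INR (n + m) + 3)); [lra|].
  unfold Rdiv. rewrite Rmult_assoc, Rinv_l by lra. nra.
Qed.

(** All coefficients are at most 1. The subtracted power lets the induction close: [|z| <= 1/2]
    gives [|z|^(N+1) <= 2|z|^(N+1) - 2|z|^(N+2)]. *)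
Lemma hyp2F1_partial_sum_bound (n N : nat) (z : C) :
  Cmod z <= 1 / 2 ->
  Cmod (Csum (hyp2F1_term 1 (1 + INR n) (3 / 2 + INR n) z) N - 1)%C
  <= 2 * Cmod z - 2 * Cmod z ^ S N.
Proof.
  intros Hz. pose proof (Cmod_ge_0 z) as Pz.
  induction N as [|N IH].
  - rewrite sum_O, hyp2F1_term_wallis, Nat.add_0_r.
    replace (wallis n / wallis n * z ^ 0 - 1)%C with (RtoC 0).
    + rewrite Cmod_0. simpl. lra.
    + simpl. field. apply wallis_neq_0.
  - rewrite Csum_S, hyp2F1_term_wallis.
    set (s := Csum _ N) in *. set (u := (_ * z ^ S N)%C).
    assert (Hu : Cmod u <= Cmod z ^ S N).
    { unfold u. rewrite Cmod_mult, Cmod_pow, <- RtoC_div, Cmod_R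
        by (apply Rgt_not_eq, wallis_pos).
      pose proof (wallis_pos n). pose proof (wallis_pos (n + S N)).
      rewrite Rabs_right by (apply Rle_ge, Rdiv_le_0_compat; lra).
      rewrite <- (Rmult_1_l (Cmod z ^ S N)) at 2.
      apply Rmult_le_compat_r; [now apply pow_le|].
      apply Rle_div_l; [lra|]. rewrite Rmult_1_l. apply wallis_decreasing. }
    replace (s + u - 1)%C with (s - 1 + u)%C by ring.
    eapply Rle_trans; [apply Cmod_triangle|].
    pose proof (pow_le (Cmod z) (S N) Pz).
    change (Cmod z ^ S (S N)) with (Cmod z * Cmod z ^ S N). nra.
Qed.

Lemma hyp2F1_sum_bound (n : nat) (z v : C) :
  Cmod z <= 1 / 2 ->
  is_hyp2F1 1 (1 + INR n)%C (3 / 2 + INR n)%C z v ->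
  Cmod (v - 1)%C <= 2 * Cmod z.
Proof.
  intros Hz Hv. apply le_epsilon. intros eps Heps.
  destruct (proj1 (filterlim_locally_ball_norm (K := C_AbsRing)
    (U := C_NormedModule) _ v) Hv (mkposreal eps Heps)) as [N HN].
  specialize (HN N (Nat.le_refl N)).
  pose proof (hyp2F1_partial_sum_bound n N z Hz) as B.
  set (s := Csum _ N) in B.
  change (Cmod (s - v)%C < eps) in HN.
  replace (v - 1)%C with (s - 1 + - (s - v))%C by ring.
  eapply Rle_trans; [apply Cmod_triangle|]. rewrite Cmod_opp.
  pose proof (pow_le (Cmod z) (S N) (Cmod_ge_0 z)). lra.
Qed.

(** At [z = 0] the partial sum bound is 0, so every partial sum equals 1. *)
Lemma hyp2F1_at_0 (n : nat) :
  is_hyp2F1 1 (1 + INR n)%C (3 / 2 + INR n)%C 0%C 1%C.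
Proof.
  apply (filterlim_ext (fun _ : nat => RtoC 1)).
  - intros N. symmetry. apply Ceq_minus, Cmod_eq_0.
    pose proof (hyp2F1_partial_sum_bound n N 0%C) as B.
    rewrite Cmod_0, pow_i in B by lia.
    apply Rle_antisym; [|apply Cmod_ge_0].
    eapply Rle_trans; [apply B|]; lra.
  - exact (filterlim_const (U := C_UniformSpace) (RtoC 1)).
Qed.

(** * The closed form and its limit at the origin *)

(** The head [k < n] is [(1-z)^(n-1) Q_(n-1)]; writing the power as [(1-z)^n / (1-z)] also covers
    [n = 0], where nothing is cut off and [Qpred] vanishes. *)
Lemma Qpred_sum_wallis (n : nat) (z v : C) :
  Cmod z < 1 ->
  is_series (K := C_AbsRing) (V := C_NormedModule)
    (fun k => RtoC (wallis k) * z ^ k)%C v ->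
  is_series (K := C_AbsRing) (V := C_NormedModule)
    (fun k => RtoC (wallis (n + k)) * z ^ (n + k))%C
    (v - (1 - z) ^ n * Qpred n (z / (1 - z)) / (1 - z))%C.
Proof.
  intros Hz Hv. pose proof (C1_minus_neq_0 z Hz) as Hz1.
  destruct n as [|p].
  - replace (v - _)%C with v; [exact Hv|].
    simpl. unfold Cdiv. ring.
  - apply (is_series_incr_n (K := C_AbsRing) (V := C_NormedModule)
      (fun k => RtoC (wallis k) * z ^ k)%C); [lia|].
    unfold Qpred.
    replace (plus _ _) with v; [exact Hv|].
    change (v = ((v - (1 - z) ^ S p * Qpoly p (z / (1 - z)) / (1 - z))
      + Csum (fun k => RtoC (wallis k) * z ^ k) p)%C).
    rewrite <- (Qpoly_sum_wallis p z Hz1), Cpow_S. field. exact Hz1.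
Qed.

Lemma is_hyp2F1_closed_form (n : nat) (z : C) :
  Cmod z < 1 -> z <> 0%C ->
  is_hyp2F1 1 (1 + INR n)%C (3 / 2 + INR n)%C z (closed_form n z).
Proof.
  intros Hz Hz0. pose proof (C1_minus_neq_0 z Hz) as Hz1.
  set (w := Csqrt (z / (1 - z))).
  assert (Hx : (z / (1 - z))%C <> 0%C).
  { intros E. apply Hz0. replace z with (z / (1 - z) * (1 - z))%C by (field; auto).
    rewrite E. ring. }
  pose proof (Csqrt_sqr _ Hx) as Hww. fold w in Hww.
  assert (Hw0 : w <> 0%C).
  { intros E. rewrite E, Cmult_0_l in Hww. auto. }
  assert (Hw : (w * w * (1 - z) = z)%C) by (rewrite Hww; field; auto).
  pose proof (Qpred_sum_wallis n z _ Hz (is_series_wallis z w Hz Hw0 Hw)) as H.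
  (* The shifted series starts with [t_n z^n]; dividing by it gives the hypergeometric normalisation
     and the prefactor [(1+2n)!!/(2n)!! = 1/t_n]. *)
  apply (is_series_scal (K := C_AbsRing) (V := C_NormedModule)
    (/ (RtoC (wallis n) * z ^ n))%C) in H.
  pose proof (Cpow_nz z n Hz0) as Hzn. pose proof (wallis_neq_0 n) as Hwn.
  unfold is_hyp2F1.
  replace (closed_form n z) with (@scal C_AbsRing C_NormedModule
     (/ (RtoC (wallis n) * z ^ n))%C (Carctan w / (w * (1 - z)) -
       (1 - z) ^ n * Qpred n (z / (1 - z)) / (1 - z))%C).
  - apply is_series_ext with (2 := H). intros m.
    rewrite hyp2F1_term_wallis, Cpow_add_r.
    change (@scal C_AbsRing C_NormedModule) with Cmult. as_eq C.
    field. auto.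
  - change (@scal C_AbsRing C_NormedModule) with Cmult.
    unfold closed_form. fold w.
    assert (E : (INR (dfact (1 + 2 * n)) / INR (dfact (2 * n)))%C
      = (/ RtoC (wallis n))%C).
    { pose proof (lt_0_INR _ (dfact_pos (1 + 2 * n))).
      pose proof (lt_0_INR _ (dfact_pos (2 * n))).
      unfold wallis. rewrite RtoC_div by lra.
      field. split; apply RtoC_neq_0; lra. }
    rewrite E. as_eq C. field. auto.
Qed.

(** Away from 0 the closed form is the sum of the series, which lies within [2|z|] of 1; the limit
    thus comes from the series, without expanding the arctangent. *)
Lemma closed_form_lim_0 (n : nat) :
  filterlim (closed_form n)
    (locally' (T := C_UniformSpace) (RtoC 0))
    (locally (T := C_UniformSpace) (RtoC 1)).
Proof.
  apply (filterlim_locally (U := C_UniformSpace)). intros eps.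
  (* The radius [1/2] allows [hyp2F1_sum_bound], and [eps/2] makes [2|z| < eps]. *)
  assert (Hd : 0 < Rmin (1 / 2) (eps / 2)).
  { apply Rmin_pos; [lra|]. pose proof (cond_pos eps). lra. }
  apply (locally_le_locally_norm (K := C_AbsRing) (V := C_NormedModule)).
  exists (mkposreal _ Hd). intros z Hz Hz0.
  assert (Hz' : Cmod z < Rmin (1 / 2) (eps / 2)).
  { replace z with (z - 0)%C by ring. exact Hz. }
  pose proof (Rmin_l (1 / 2) (eps / 2)). pose proof (Rmin_r (1 / 2) (eps / 2)).
  apply (norm_compat1 (K := C_AbsRing) (V := C_NormedModule)).
  change (Cmod (closed_form n z - 1)%C < eps).
  eapply Rle_lt_trans.
  - apply (hyp2F1_sum_bound n z); [lra|].
    apply is_hyp2F1_closed_form; [lra|exact Hz0].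
  - lra.
Qed.

Theorem mainTheorem9 :
  forall (n : nat) (z : C), Cmod z < 1 ->
    (z <> 0 ->
       is_hyp2F1 1 (1 + INR n)%C (3 / 2 + INR n)%C z (closed_form n z)) /\
    (z = 0 ->
       exists v : C,
         filterlim (closed_form n)
           (locally' (T := C_UniformSpace) (RtoC 0)) (locally (T := C_UniformSpace) v) /\
         is_hyp2F1 1 (1 + INR n)%C (3 / 2 + INR n)%C z v).
Proof.
  intros n z Hz. split.
  - exact (is_hyp2F1_closed_form n z Hz).
  - intros ->. exists (RtoC 1).
    split; [apply closed_form_lim_0|apply hyp2F1_at_0].
Qed.
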